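(* Let $F$ be a field of arbitrary characteristic and $V=F^n$ an $n$-dimensional vector space over $F$. The $\mathbb Z_2$-graded algebra $\Gamma[\emptyset;V]=F[Gr(2,V)]+F[Gr(2,V)]_1$ (even part $F[Gr(2,V)]$, odd part $F[Gr(2,V)]_1$) is a free $\Gamma$-algebra generated by the space of odd generators $V$.
   Context: Algebras are not assumed associative; $[a,b]=ab-ba$, $(a,b,c)=(ab)c-a(bc)$, and $Z(\cdot)$ denotes the center. A $\Gamma$-algebra is a $\mathbb Z_2$-graded $F$-algebra $\Gamma=\Gamma_0\oplus\Gamma_1$ such that: (i) $\Gamma_0$ is a unital associative algebra (whose identity is the identity of $\Gamma$), $[\Gamma_0,\Gamma_1]=0$ and $(\Gamma_0,\Gamma,\Gamma)=0$ (associators whose first entry is in $\Gamma_0$ vanish); (ii) $\Gamma_1^2\subseteq Z(\Gamma_0)$; (iii) $xy+yx=0$ for $x,y\in\Gamma_1$; (iv) $(xy)z+(yz)x+(zx)y=0$ for $x,y,z\in\Gamma_1$. Homomorphisms are unital and preserve the grading. $F[V^{\wedge2}]$ is the polynomial (symmetric) algebra over the vector space $V^{\wedge 2}=\bigwedge^2V$, and $F[Gr(2,V)]=F[V^{\wedge2}]/P$, where $P$ is the ideal generated by all $(u\wedge v)(w\wedge z)+(u\wedge w)(z\wedge v)+(u\wedge z)(v\wedge w)$, $u,v,w,z\in V$. $F[Gr(2,V)]_1$ is the quotient of the $F[Gr(2,V)]$-module $F[Gr(2,V)]\otimes_F V$ by the submodule generated by all $(u\wedge v)\otimes w+(v\wedge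 w)\otimes u+(w\wedge u)\otimes v$, $u,v,w\in V$. The product on $\Gamma[\emptyset;V]$ is: the algebra product on $F[Gr(2,V)]$; the module action (on both sides) of $F[Gr(2,V)]$ on $F[Gr(2,V)]_1$; and, for odd elements, $(a\otimes u)(b\otimes v)=ab(u\wedge v)$ (this is well defined). $V$ is mapped into the odd part by $v\mapsto 1\otimes v$. ''Free $\Gamma$-algebra generated by the space $V$ of odd generators'' means: for every $\Gamma$-algebra $\Gamma$, every linear map $V\to\Gamma_1$ extends uniquely to a homomorphism of $\Gamma$-algebras from it to $\Gamma$.
   Formalization: In characteristic 2 the exterior square of V is taken modulo u∧v = −v∧u only, without u∧u = 0, since with u∧u = 0 the freeness claim fails there for every n ≥ 1; in all other characteristics it is the usual exterior square. *)

(* Defs.v *)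
From HB Require Import structures.
From mathcomp Require Import all_boot all_algebra.
From mathcomp.multinomials Require Import monalg.
From mathcomp Require Import boolp.

Set Implicit Arguments.
Unset Strict Implicit.
Unset Printing Implicit Defensive.

Import GRing.Theory.
Local Open Scope ring_scope.
Local Open Scope quotient_scope.

Section GeneratedSubmodule.
Variables (R : pzRingType) (M : lmodType R) (S : M -> Prop).

Definition spanned (x : M) : Prop :=
  exists s : seq (R * M),
    (forall p, p \in s -> S p.2) /\ x = \sum_(p <- s) p.1 *: p.2.

Definition gen_submod : {pred M} := fun x => `[< spanned x >].

Lemma gen_submodP x : reflect (spanned x) (x \in gen_submod).
Proof. exact: asboolP. Qed.

Lemma gen_submod_gen x : S x -> x \in gen_submod.
Proof.
move=> Sx; apply/gen_submodP; exists [:: (1, x)]; split.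
  by move=> p; rewrite inE => /eqP->.
by rewrite big_seq1 scale1r.
Qed.

Lemma gen_submod_closed : submod_closed gen_submod.
Proof.
split=> [|a x y /gen_submodP[s [Ss ->]] /gen_submodP[t [St ->]]].
  by apply/gen_submodP; exists [::]; split=> //; rewrite big_nil.
apply/gen_submodP; exists ([seq (a * p.1, p.2) | p <- s] ++ t); split.
  by move=> p; rewrite mem_cat => /orP[/mapP[q /Ss Sq ->]|/St].
rewrite big_cat big_map scaler_sumr /=; congr (_ + _).
by apply: eq_bigr => p _; rewrite scalerA.
Qed.

HB.instance Definition _ :=
  GRing.isSubmodClosed.Build R M gen_submod gen_submod_closed.

Lemma gen_submod_min (T : {pred M}) :
    submod_closed T -> (forall x, S x -> x \in T) -> {subset gen_submod <= T}.
Proof.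
move=> [T0 Tlin] ST x /gen_submodP[s [Ss ->]]; elim: s Ss => [|p s IH] Ss.
  by rewrite big_nil.
rewrite big_cons; apply: Tlin; first by apply/ST/Ss; rewrite mem_head.
by apply: IH => q qs; apply: Ss; rewrite inE qs orbT.
Qed.

(* A record rather than an alias of the library quotient, so that distinct
   quotients have rigidly distinct types for unification. *)
Record quotmod : Type := QuotMod { quotmod_val : Quotient.quot gen_submod }.

HB.instance Definition _ := [isNew for quotmod_val].
HB.instance Definition _ := [Choice of quotmod by <:].

Definition qzero : quotmod := QuotMod 0.
Definition qopp (x : quotmod) : quotmod := QuotMod (- quotmod_val x).
Definition qadd (x y : quotmod) : quotmod :=
  QuotMod (quotmod_val x + quotmod_val y).

Fact qaddA : associative qadd.
Proof. by move=> x y z; apply: val_inj; apply: addrA. Qed.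

Fact qaddC : commutative qadd.
Proof. by move=> x y; apply: val_inj; apply: addrC. Qed.

Fact qadd0 : left_id qzero qadd.
Proof. by move=> x; apply: val_inj; apply: add0r. Qed.

Fact qaddN : left_inverse qzero qopp qadd.
Proof. by move=> x; apply: val_inj; apply: addNr. Qed.

HB.instance Definition _ := GRing.isZmodule.Build quotmod qaddA qaddC qadd0 qaddN.

Definition qproj (x : M) : quotmod := QuotMod (\pi x).
Definition qrepr (x : quotmod) : M := repr (quotmod_val x).

Lemma qreprK x : qproj (qrepr x) = x.
Proof. by apply: val_inj; apply: reprK. Qed.

Lemma qprojP x y : reflect (qproj x = qproj y) (x - y \in gen_submod).
Proof.
by rewrite Quotient.idealrBE; apply: (iffP eqP) => [exy|[]//]; apply: val_inj.
Qed.

Lemma qproj_is_zmod_morphism : zmod_morphism qproj.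
Proof.
by move=> x y; apply: val_inj; apply: (raddfB (\pi_(Quotient.quot gen_submod))).
Qed.

HB.instance Definition _ :=
  GRing.isZmodMorphism.Build M quotmod qproj qproj_is_zmod_morphism.

Lemma qprojW (P : quotmod -> Prop) : (forall x, P (qproj x)) -> forall x, P x.
Proof. by move=> Pq x; rewrite -[x]qreprK. Qed.

Definition qscale (c : R) (x : quotmod) : quotmod := qproj (c *: qrepr x).

Lemma qproj_scale c x : qproj (c *: x) = qscale c (qproj x).
Proof.
apply/qprojP; rewrite -scalerBr; apply: rpredZ.
by apply/qprojP; rewrite qreprK.
Qed.

Fact qscaleA a b v : qscale a (qscale b v) = qscale (a * b) v.
Proof. by elim/qprojW: v => x; rewrite -!qproj_scale scalerA. Qed.

Fact qscale1 : left_id 1 qscale.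
Proof. by elim/qprojW => x; rewrite -qproj_scale scale1r. Qed.

Fact qscaleDr : right_distributive qscale +%R.
Proof.
move=> a; elim/qprojW=> x; elim/qprojW=> y.
by rewrite -raddfD -!qproj_scale scalerDr raddfD.
Qed.

Fact qscaleDl v : {morph qscale^~ v : a b / a + b}.
Proof. by move=> a b; elim/qprojW: v => x; rewrite -!qproj_scale scalerDl raddfD. Qed.

HB.instance Definition _ :=
  GRing.Zmodule_isLmodule.Build R quotmod qscaleA qscale1 qscaleDr qscaleDl.

HB.instance Definition _ :=
  GRing.isScalable.Build R M quotmod *:%R qproj qproj_scale.

End GeneratedSubmodule.

Section GeneratedIdeal.
Variables (R : comPzRingType) (S : R -> Prop).

(* The ideals of R are the submodules of the regular module R^o. *)
Definition quotring : Type := @quotmod R R^o S.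

HB.instance Definition _ := GRing.Zmodule.on quotring.

Definition rproj (x : R) : quotring := @qproj R R^o S x.

Lemma rproj_is_zmod_morphism : zmod_morphism rproj.
Proof. exact: (raddfB (@qproj R R^o S)). Qed.

HB.instance Definition _ :=
  GRing.isZmodMorphism.Build R quotring rproj rproj_is_zmod_morphism.

Lemma rprojW (P : quotring -> Prop) : (forall x, P (rproj x)) -> forall x, P x.
Proof. exact: (@qprojW R R^o S P). Qed.

Lemma rproj_gen x : S x -> rproj x = 0.
Proof.
by move=> Sx; rewrite -(raddf0 rproj); apply/qprojP; rewrite subr0 gen_submod_gen.
Qed.

End GeneratedIdeal.

HB.lock Definition rmul (R : comPzRingType) (S : R -> Prop) (x y : quotring S) :
  quotring S := rproj S (qrepr x * qrepr y).

Section QuotientRing.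
Variables (R : comPzRingType) (S : R -> Prop).
Local Notation quotring := (quotring S).
Local Notation rproj := (rproj S).
Local Notation rmul := (@rmul R S).

Definition rone : quotring := rproj 1.

Lemma rproj_mul x y : rproj (x * y) = rmul (rproj x) (rproj y).
Proof.
rewrite rmul.unlock; apply/qprojP; set x' := qrepr _; set y' := qrepr _.
have Ix : x - x' \in @gen_submod R R^o S by apply/qprojP; rewrite qreprK.
have Iy : y - y' \in @gen_submod R R^o S by apply/qprojP; rewrite qreprK.
have -> : x * y - x' * y' = y *: (x - x' : R^o) + x' *: (y - y' : R^o).
  by rewrite /GRing.scale /= mulrBr mulrBr addrA [y * x]mulrC [y * x']mulrC subrK.
by apply: rpredD; apply: rpredZ.
Qed.

Fact rmulA : associative rmul.
Proof.
elim/rprojW=> x; elim/rprojW=> y; elim/rprojW=> z.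
by rewrite -!rproj_mul mulrA.
Qed.

Fact rmulC : commutative rmul.
Proof. by elim/rprojW=> x; elim/rprojW=> y; rewrite -!rproj_mul mulrC. Qed.

Fact rmul1 : left_id rone rmul.
Proof. by elim/rprojW=> x; rewrite -rproj_mul mul1r. Qed.

Fact rmulDl : left_distributive rmul +%R.
Proof.
elim/rprojW=> x; elim/rprojW=> y; elim/rprojW=> z.
by rewrite -raddfD -!rproj_mul mulrDl raddfD.
Qed.

HB.instance Definition _ :=
  GRing.Zmodule_isComPzRing.Build quotring rmulA rmulC rmul1 rmulDl.

Lemma rproj_is_monoid_morphism : monoid_morphism rproj.
Proof. by split=> // x y; rewrite rproj_mul. Qed.

HB.instance Definition _ :=
  GRing.isMonoidMorphism.Build R quotring rproj rproj_is_monoid_morphism.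

End QuotientRing.

Record gradedAlg (F : fieldType) := GradedAlg {
  carrier :> lmodType F;
  amul : carrier -> carrier -> carrier;
  (* [part false] is the even component, [part true] the odd one. *)
  part : bool -> carrier -> Prop;
  amul_linearl : forall c x y z,
    amul (c *: x + y) z = c *: amul x z + amul y z;
  amul_linearr : forall c x y z,
    amul z (c *: x + y) = c *: amul z x + amul z y;
  part0 : forall b, part b 0;
  part_linear : forall b c x y, part b x -> part b y -> part b (c *: x + y);
  part_sum : forall x, exists x0 x1,
    [/\ part false x0, part true x1 & x = x0 + x1];
  part_direct : forall x, part false x -> part true x -> x = 0;
  part_mul : forall b b' x y, part b x -> part b' y -> part (b (+) b') (amul x y)
}.

Section GammaAlgebra.
Variables (F : fieldType).

Definition comm (A : gradedAlg F) (a b : A) : A := amul a b - amul b a.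

Definition asso (A : gradedAlg F) (a b c : A) : A :=
  amul (amul a b) c - amul a (amul b c).

Definition is_identity (A : gradedAlg F) (e : A) : Prop :=
  forall x : A, amul e x = x /\ amul x e = x.

Definition center (A : gradedAlg F) (B : A -> Prop) (z : A) : Prop :=
  [/\ B z, (forall a, B a -> comm z a = 0) &
      forall a b, B a -> B b ->
        [/\ asso z a b = 0, asso a z b = 0 & asso a b z = 0]].

Definition is_gamma (A : gradedAlg F) : Prop :=
  let G0 : A -> Prop := part false in
  let G1 : A -> Prop := part true in
  [/\ [/\ exists e : A, G0 e /\ is_identity e,
          forall a b c, G0 a -> G0 b -> G0 c -> asso a b c = 0,
          forall a x, G0 a -> G1 x -> comm a x = 0 &
          forall a x y, G0 a -> asso a x y = 0],
      forall x y, G1 x -> G1 y -> center G0 (amul x y),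
      forall x y, G1 x -> G1 y -> amul x y + amul y x = 0 &
      forall x y z, G1 x -> G1 y -> G1 z ->
        amul (amul x y) z + amul (amul y z) x + amul (amul z x) y = 0].

Definition is_gamma_hom (A B : gradedAlg F) (phi : {linear A -> B}) : Prop :=
  [/\ forall x y, phi (amul x y) = amul (phi x) (phi y),
      forall e, is_identity e -> is_identity (phi e) &
      forall b x, part b x -> part b (phi x)].

Definition is_free_gamma (V : lmodType F) (G : gradedAlg F) (i : V -> G) : Prop :=
  [/\ is_gamma G, linear i, forall v, part true (i v) &
      forall (H : gradedAlg F) (f : {linear V -> H}),
        is_gamma H -> (forall v, part true (f v)) ->
        (exists phi : {linear G -> H},
           is_gamma_hom phi /\ forall v, phi (i v) = f v) /\
        (forall phi psi : {linear G -> H},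
           is_gamma_hom phi -> (forall v, phi (i v) = f v) ->
           is_gamma_hom psi -> (forall v, psi (i v) = f v) -> phi =1 psi)].

End GammaAlgebra.

(* Locked, as the unfolding of monomials is expensive for unification. *)
HB.lock Definition symvar (F : fieldType) (W : lmodType F) (w : W) :
  {malg F[{cmonom W}]} := << ucm w >>.

Section SymmetricAlgebra.
Variables (F : fieldType) (W : lmodType F).

Definition symrel (p : {malg F[{cmonom W}]}) : Prop :=
  (exists w w', p = symvar (w + w') - symvar w - symvar w') \/
  (exists c w, p = symvar (c *: w) - c *: symvar w).

(* Polynomials in variables indexed by all the vectors of W, modulo linearity;
   the choice of a basis of W identifies it with the polynomials in the basis. *)
Definition symalg : Type := quotring symrel.

HB.instance Definition _ := GRing.ComPzRing.on symalg.

Definition symproj (p : {malg F[{cmonom W}]}) : symalg := rproj symrel p.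

Lemma symproj_is_zmod_morphism : zmod_morphism symproj.
Proof. exact: rproj_is_zmod_morphism. Qed.

Lemma symproj_is_monoid_morphism : monoid_morphism symproj.
Proof. exact: rproj_is_monoid_morphism. Qed.

HB.instance Definition _ := GRing.isZmodMorphism.Build
  {malg F[{cmonom W}]} symalg symproj symproj_is_zmod_morphism.
HB.instance Definition _ := GRing.isMonoidMorphism.Build
  {malg F[{cmonom W}]} symalg symproj symproj_is_monoid_morphism.

Lemma symprojD x y : symproj (x + y) = symproj x + symproj y. Proof. exact: raddfD. Qed.
Lemma symprojB x y : symproj (x - y) = symproj x - symproj y. Proof. exact: raddfB. Qed.
Lemma symprojN x : symproj (- x) = - symproj x. Proof. exact: raddfN. Qed.
Lemma symprojM x y : symproj (x * y) = symproj x * symproj y. Proof. exact: rmorphM. Qed.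

Lemma symprojW (P : symalg -> Prop) : (forall p, P (symproj p)) -> forall x, P x.
Proof. exact: rprojW. Qed.

Lemma symproj_rel p : symrel p -> symproj p = 0.
Proof. exact: rproj_gen. Qed.

End SymmetricAlgebra.

HB.lock Definition symC (F : fieldType) (W : lmodType F) (c : F) : symalg W :=
  symproj c%:MP.

Section SymmetricAlgebraTheory.
Variables (F : fieldType) (W : lmodType F).
Local Notation symC := (@symC F W).
Local Notation symproj := (@symproj F W).

Lemma symC_is_zmod_morphism : zmod_morphism symC.
Proof. by move=> c d; rewrite symC.unlock raddfB symprojB. Qed.

Lemma symC_is_monoid_morphism : monoid_morphism symC.
Proof.
have [MCM MC1] := @malgC_is_multiplicative {cmonom W} F.
split=> [|c d]; rewrite symC.unlock; first by rewrite MC1 (rmorph1 symproj).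
by rewrite MCM symprojM.
Qed.

HB.instance Definition _ :=
  GRing.isZmodMorphism.Build F (symalg W) symC symC_is_zmod_morphism.
HB.instance Definition _ :=
  GRing.isMonoidMorphism.Build F (symalg W) symC symC_is_monoid_morphism.

Definition symgen (w : W) : symalg W := symproj (symvar w).

Lemma symgenD w w' : symgen (w + w') = symgen w + symgen w'.
Proof.
apply/eqP; rewrite -subr_eq0 opprD addrA -!symprojB; apply/eqP.
by apply: symproj_rel; left; exists w, w'.
Qed.

Lemma symgenZ c w : symgen (c *: w) = symC c * symgen w.
Proof.
apply/eqP; rewrite symC.unlock -subr_eq0 -symprojM -symprojB; apply/eqP.
by apply: symproj_rel; right; exists c, w; rewrite mul_malgC.
Qed.

End SymmetricAlgebraTheory.

Section FreeGamma.
Variables (F : fieldType) (n : nat).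
Local Notation V := 'rV[F]_n.

(* 'M_n is V (x) V, with u (x) v the rank one matrix u^T *m v. The exterior
   square V^2 is its quotient by the relation v /\ u = - u /\ v, which implies
   u /\ u = 0 when 2 != 0 (lemma wedge_alt), where this is the usual exterior
   square. In characteristic 2, u /\ u = 0 is not imposed: odd elements of
   Gamma-algebras only satisfy x y + y x = 0, and may have x x != 0. *)
Definition skewrel (t : 'M[F]_n) : Prop :=
  exists u v : V, t = u^T *m v + v^T *m u.

Definition ext2 : Type := quotmod skewrel.

HB.instance Definition _ := GRing.Lmodule.on ext2.

Definition wedge (u v : V) : ext2 := qproj skewrel (u^T *m v).

Lemma wedgeC u v : wedge v u = - wedge u v.
Proof.
apply/eqP; rewrite -addr_eq0 -raddfD -(raddf0 (qproj skewrel)).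
by apply/eqP/qprojP; rewrite subr0 gen_submod_gen //; exists v, u.
Qed.

Lemma wedge_alt u : 2%:R != 0 :> F -> wedge u u = 0.
Proof.
move=> n2; have: 2%:R *: wedge u u = 0.
  by rewrite scaler_nat mulr2n {1}wedgeC addNr.
by move/eqP; rewrite scaler_eq0 (negPf n2) => /eqP.
Qed.

Lemma wedge_linearl c u u' v : wedge (c *: u + u') v = c *: wedge u v + wedge u' v.
Proof. by rewrite /wedge linearP mulmxDl -scalemxAl linearP. Qed.

Definition plucker (p : symalg ext2) : Prop :=
  exists u v w z : V,
    p = symgen (wedge u v) * symgen (wedge w z)
      + symgen (wedge u w) * symgen (wedge z v)
      + symgen (wedge u z) * symgen (wedge v w).

Definition grring : Type := quotring plucker.

HB.instance Definition _ := GRing.ComPzRing.on grring.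

Definition grproj (x : symalg ext2) : grring := rproj plucker x.

Lemma grproj_is_zmod_morphism : zmod_morphism grproj.
Proof. exact: rproj_is_zmod_morphism. Qed.

Lemma grproj_is_monoid_morphism : monoid_morphism grproj.
Proof. exact: rproj_is_monoid_morphism. Qed.

HB.instance Definition _ := GRing.isZmodMorphism.Build
  (symalg ext2) grring grproj grproj_is_zmod_morphism.
HB.instance Definition _ := GRing.isMonoidMorphism.Build
  (symalg ext2) grring grproj grproj_is_monoid_morphism.

Lemma grprojD x y : grproj (x + y) = grproj x + grproj y. Proof. exact: raddfD. Qed.
Lemma grprojB x y : grproj (x - y) = grproj x - grproj y. Proof. exact: raddfB. Qed.
Lemma grprojN x : grproj (- x) = - grproj x. Proof. exact: raddfN. Qed.
Lemma grprojM x y : grproj (x * y) = grproj x * grproj y. Proof. exact: rmorphM. Qed.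

Lemma grprojW (P : grring -> Prop) : (forall p, P (grproj p)) -> forall x, P x.
Proof. exact: rprojW. Qed.

Lemma grproj_rel p : plucker p -> grproj p = 0.
Proof. exact: rproj_gen. Qed.

Definition grC : F -> grring := grproj \o symC ext2.

HB.instance Definition _ := GRing.RMorphism.on grC.

Definition grw (u v : V) : grring := grproj (symgen (wedge u v)).

Lemma grw_linearl c u u' v : grw (c *: u + u') v = grC c * grw u v + grw u' v.
Proof.
by rewrite /grw wedge_linearl symgenD symgenZ grprojD grprojM.
Qed.

Lemma grwC u v : grw v u = - grw u v.
Proof.
by rewrite /grw wedgeC -scaleN1r symgenZ (rmorphN1 (symC _)) mulN1r grprojN.
Qed.

Lemma grw_linearr c u u' v : grw v (c *: u + u') = grC c * grw v u + grw v u'.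
Proof. by rewrite grwC grw_linearl opprD [grw v u]grwC [grw v u']grwC mulrN. Qed.

Lemma grw_plucker u v w z :
  grw u v * grw w z + grw u w * grw z v + grw u z * grw v w = 0.
Proof.
have: plucker (symgen (wedge u v) * symgen (wedge w z)
             + symgen (wedge u w) * symgen (wedge z v)
             + symgen (wedge u z) * symgen (wedge v w)) by exists u, v, w, z.
by move/grproj_rel; rewrite !grprojD !grprojM.
Qed.

(* As V = F^n, the module F[Gr(2, V)] (x)_F V is the free module of rows of
   length n over F[Gr(2, V)], with a (x) v = a *: rowC v. *)
Definition rowC (v : V) : 'rV[grring]_n := map_mx grC v.

Definition oddrel (t : 'rV[grring]_n) : Prop :=
  exists u v w : V,
    t = grw u v *: rowC w + grw v w *: rowC u + grw w u *: rowC v.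

Definition grodd : Type := quotmod oddrel.

HB.instance Definition _ := GRing.Lmodule.on grodd.

Definition otens (a : grring) (v : V) : grodd := qproj oddrel (a *: rowC v).

Definition rowprod (x y : 'rV[grring]_n) : grring :=
  \sum_(i < n) \sum_(j < n) x 0 i * y 0 j * grw (delta_mx 0 i) (delta_mx 0 j).

Definition oddmul (x y : grodd) : grring := rowprod (qrepr x) (qrepr y).

Lemma rowprod_linearl c x y z :
  rowprod (c *: x + y) z = c * rowprod x z + rowprod y z.
Proof.
rewrite /rowprod mulr_sumr -big_split; apply: eq_bigr => i _ /=.
rewrite mulr_sumr -big_split; apply: eq_bigr => j _ /=.
by rewrite !mxE !mulrDl !mulrA.
Qed.

Lemma rowprodC x y : rowprod y x = - rowprod x y.
Proof.
rewrite /rowprod exchange_big -sumrN; apply: eq_bigr => i _ /=.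
rewrite -sumrN; apply: eq_bigr => j _.
by rewrite grwC mulrN [y 0 j * _]mulrC.
Qed.

Lemma rowprod_linearr c x y z :
  rowprod z (c *: x + y) = c * rowprod z x + rowprod z y.
Proof.
by rewrite rowprodC rowprod_linearl opprD [rowprod z x]rowprodC
  [rowprod z y]rowprodC mulrN.
Qed.

Lemma grw_suml (I : Type) (r : seq I) (c : I -> F) (u : I -> V) v :
  grw (\sum_(i <- r) c i *: u i) v = \sum_(i <- r) grC (c i) * grw (u i) v.
Proof.
elim: r => [|i r IH]; last by rewrite !big_cons grw_linearl IH.
rewrite !big_nil; have := grw_linearl (-1) 0 0 v.
by rewrite scaler0 addr0 rmorphN1 mulN1r addNr.
Qed.

Lemma grw_sumr (I : Type) (r : seq I) (c : I -> F) (u : I -> V) v :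
  grw v (\sum_(i <- r) c i *: u i) = \sum_(i <- r) grC (c i) * grw v (u i).
Proof.
rewrite grwC grw_suml -sumrN; apply: eq_bigr => i _.
by rewrite grwC mulrN opprK.
Qed.

Lemma scale_rowCE a v i : (a *: rowC v) 0 i = a * grC (v 0 i).
Proof. by rewrite !mxE. Qed.

Lemma rowprodE a b u v :
  rowprod (a *: rowC u) (b *: rowC v) = a * b * grw u v.
Proof.
rewrite {2}(row_sum_delta u) {2}(row_sum_delta v) grw_suml mulr_sumr.
apply: eq_bigr => i _; rewrite grw_sumr !mulr_sumr; apply: eq_bigr => j _.
rewrite !scale_rowCE; move: (grC _) (grC _) (grw _ _) => p q r.
by rewrite mulrACA !mulrA.
Qed.

Lemma rowprod0r x : rowprod x 0 = 0.
Proof.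
rewrite /rowprod big1 // => i _; rewrite big1 // => j _.
by rewrite mxE mulr0 mul0r.
Qed.

Lemma row_sum_rowC (y : 'rV[grring]_n) :
  y = \sum_(i < n) y 0 i *: rowC (delta_mx 0 i).
Proof.
rewrite {1}(row_sum_delta y); apply: eq_bigr => i _; congr (_ *: _).
by rewrite /rowC map_delta_mx.
Qed.

Lemma rowprod_oddrel t y : oddrel t -> rowprod t y = 0.
Proof.
move=> [u [v [w ->]]]; rewrite (row_sum_rowC y).
elim/big_rec: _ => [|i x _ IH]; first exact: rowprod0r.
rewrite rowprod_linearr IH addr0; set z := delta_mx 0 i.
have E (a : grring) x1 : rowprod (a *: rowC x1) (rowC z) = a * grw x1 z.
  by rewrite -[rowC z]scale1r rowprodE mulr1.
rewrite -addrA !rowprod_linearl -[grw w u *: rowC v]addr0 rowprod_linearl.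
have -> : rowprod 0 (rowC z) = 0 by rewrite rowprodC rowprod0r oppr0.
rewrite addr0 -[rowC w]scale1r -[rowC u]scale1r -[rowC v]scale1r !E !mul1r.
rewrite [X in _ + X]addrC addrA [grw w u]grwC [grw v z]grwC mulrNN.
by rewrite [grw v w * _]mulrC grw_plucker mulr0.
Qed.

Lemma rowprod_gen t y : t \in gen_submod oddrel -> rowprod t y = 0.
Proof.
move=> /gen_submodP[s [Ss ->]]; elim: s Ss => [|p s IH] Ss.
  by rewrite big_nil rowprodC rowprod0r oppr0.
rewrite big_cons rowprod_linearl IH; last first.
  by move=> q qs; apply: Ss; rewrite inE qs orbT.
by rewrite rowprod_oddrel ?mulr0 ?addr0 //; apply: Ss; rewrite mem_head.
Qed.

Lemma rowprod_congl x x' y : qproj oddrel x = qproj oddrel x' ->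
  rowprod x y = rowprod x' y.
Proof.
move/qprojP/(rowprod_gen y); rewrite -scaleN1r addrC rowprod_linearl.
by rewrite mulN1r addrC => /eqP; rewrite subr_eq0 => /eqP.
Qed.

Lemma oddmulE x y : oddmul (qproj oddrel x) (qproj oddrel y) = rowprod x y.
Proof.
rewrite /oddmul (@rowprod_congl _ x) ?qreprK // rowprodC (@rowprod_congl _ y).
  by rewrite -rowprodC.
by rewrite qreprK.
Qed.

Lemma oddmul_otens a b u v :
  oddmul (otens a u) (otens b v) = a * b * grw u v.
Proof. by rewrite /otens oddmulE rowprodE. Qed.

Lemma oddmul_linearl c x y z : oddmul (c *: x + y) z = c * oddmul x z + oddmul y z.
Proof.
elim/qprojW: x => x; elim/qprojW: y => y; elim/qprojW: z => z.
by rewrite -linearP !oddmulE rowprod_linearl.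
Qed.

Lemma oddmul_linearr c x y z : oddmul z (c *: x + y) = c * oddmul z x + oddmul z y.
Proof.
elim/qprojW: x => x; elim/qprojW: y => y; elim/qprojW: z => z.
by rewrite -linearP !oddmulE rowprod_linearr.
Qed.

Definition gammaT : Type := (grring * grodd)%type.

HB.instance Definition _ := GRing.Zmodule.on gammaT.

Definition gscale (c : F) (x : gammaT) : gammaT := (grC c * x.1, grC c *: x.2).

Fact gscaleA a b x : gscale a (gscale b x) = gscale (a * b) x.
Proof. by rewrite /gscale /= rmorphM mulrA scalerA. Qed.

Fact gscale1 : left_id 1 gscale.
Proof. by case=> a x; rewrite /gscale rmorph1 mul1r scale1r. Qed.

Fact gscaleDr : right_distributive gscale +%R.
Proof.
by move=> c [a x] [b y]; congr (_, _); [apply: mulrDr | apply: scalerDr].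
Qed.

Fact gscaleDl x : {morph gscale^~ x : a b / a + b}.
Proof.
by move=> a b; congr (_, _); rewrite rmorphD; [apply: mulrDl | apply: scalerDl].
Qed.

HB.instance Definition _ :=
  GRing.Zmodule_isLmodule.Build F gammaT gscaleA gscale1 gscaleDr gscaleDl.

Definition gmul (x y : gammaT) : gammaT :=
  (x.1 * y.1 + oddmul x.2 y.2, x.1 *: y.2 + y.1 *: x.2).

(* [gpart false] is F[Gr(2, V)] and [gpart true] is F[Gr(2, V)]_1. *)
Definition gpart (b : bool) (x : gammaT) : Prop :=
  if b then x.1 = 0 else x.2 = 0.

Lemma pair_eq (x y : gammaT) : x.1 = y.1 -> x.2 = y.2 -> x = y.
Proof. by case: x y => [? ?] [? ?] /= -> ->. Qed.

Fact gmul_linearl c x y z : gmul (c *: x + y) z = c *: gmul x z + gmul y z.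
Proof.
case: x y z => [a x] [b y] [d z]; apply: pair_eq => /=.
  by rewrite oddmul_linearl mulrDl mulrDr mulrA addrACA.
by rewrite !(scalerDl, scalerDr) !scalerA [d * _]mulrC addrACA.
Qed.

Fact gmul_linearr c x y z : gmul z (c *: x + y) = c *: gmul z x + gmul z y.
Proof.
case: x y z => [a x] [b y] [d z]; apply: pair_eq => /=.
  by rewrite oddmul_linearr !mulrDr mulrCA addrACA.
by rewrite !(scalerDl, scalerDr) !scalerA [d * _]mulrC addrACA.
Qed.

Fact gpart0 b : gpart b 0. Proof. by case: b. Qed.

Fact gpart_linear b c x y : gpart b x -> gpart b y -> gpart b (c *: x + y).
Proof.
case: b x y => [] [a x] [d y] /= -> ->.
  by rewrite mulr0 addr0.
by rewrite scaler0 addr0.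
Qed.

Fact gpart_sum x : exists x0 x1, [/\ gpart false x0, gpart true x1 & x = x0 + x1].
Proof.
case: x => a x; exists (a, 0), (0, x); split=> //.
by apply: pair_eq; rewrite /= ?addr0 ?add0r.
Qed.

Fact gpart_direct x : gpart false x -> gpart true x -> x = 0.
Proof. by case: x => a x /= -> ->. Qed.

Fact gpart_mul b b' x y :
  gpart b x -> gpart b' y -> gpart (b (+) b') (gmul x y).
Proof.
have om0 z : oddmul z 0 = 0.
  by have := oddmul_linearr (-1) 0 0 z; rewrite scaler0 addr0 mulN1r addNr.
have om0' z : oddmul 0 z = 0.
  by have := oddmul_linearl (-1) 0 0 z; rewrite scaler0 addr0 mulN1r addNr.
case: b b' x y => [] [] [a x] [d y] /= -> ->.
- by rewrite !scale0r addr0.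
- by rewrite mul0r add0r om0.
- by rewrite mulr0 add0r om0'.
- by rewrite !scaler0 addr0.
Qed.

Definition gamma_free : gradedAlg F :=
  GradedAlg gmul_linearl gmul_linearr gpart0 gpart_linear gpart_sum
    gpart_direct gpart_mul.

Definition gamma_gen (v : V) : gamma_free := (0, otens 1 v).

End FreeGamma.

(* Main.v *)
Require Import Defs.
From HB Require Import structures.
From mathcomp Require Import all_boot all_algebra.
From mathcomp Require Import finmap.
From mathcomp.multinomials Require Import monalg.
From mathcomp Require Import boolp.

(** Why the theorem is true.

    The algebra is built by generators and relations, so the point is that
    every relation imposed is forced in every Gamma-algebra, and that the
    result is already a Gamma-algebra.

    In a Gamma-algebra H with f : V -> H_1, the products f u * f v lie in the
    center Z of H_0, which is a commutative associative ring.  They are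
    skew in u, v, and the Pluecker relation is the cyclic identity for three
    odd elements multiplied on the right by a fourth one, since even elements
    associate on the left ([odd_plucker]).  Hence there is a ring morphism g
    from F[Gr(2, V)] to Z sending u /\ v to f u * f v ([even_lift]).  On the odd
    part, a (x) v must go to g a * f v, and the cyclic identity in H is exactly
    what makes this vanish on the defining relations.  The sum of the two maps
    is multiplicative because an even factor can be pulled out of either odd
    factor of a product ([odd_even_mulA]); this is [gamma_lift].

    That the construction is itself a Gamma-algebra comes down to the cyclic
    identity for arbitrary odd elements; it is trilinear over F[Gr(2, V)], so it
    follows from its instances on V, which are the defining relations
    ([oddmul_cyclic]).

    Uniqueness holds because the identity and the elements of V generate: the
    polynomials in the u /\ v = u * v exhaust the even part ([grring_ind]),
    and the combinations of V with even coefficients the odd part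
    ([grodd_ind]).

    The ring Z is nonzero unless H is, as polynomials are evaluated in nonzero
    rings; the zero algebra H is treated apart, in the theorem itself. *)

Set Implicit Arguments.
Unset Strict Implicit.
Unset Printing Implicit Defensive.

Import GRing.Theory.
Local Open Scope ring_scope.

(** * Universal properties of quotients *)

(** The target is only an additive group, with the stability of the kernel in
    place of linearity: this covers ring morphisms as well as maps that are
    semilinear along a change of scalars. *)
Lemma quotmod_lift (R : pzRingType) (M : lmodType R) (S : M -> Prop)
    (N : zmodType) (g : {additive M -> N}) :
    (forall c x, g x = 0 -> g (c *: x) = 0) -> (forall x, S x -> g x = 0) ->
  exists h : {additive quotmod S -> N}, forall x, h (qproj S x) = g x.
Proof.
move=> gZ gS; pose T : {pred M} := fun x => g x == 0.
have subT : {subset gen_submod S <= T}.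
  apply: gen_submod_min => [|x Sx]; last by apply/eqP/gS.
  split=> [|c x y /eqP gx /eqP gy]; rewrite /in_mem /= /T ?raddf0 //.
  by rewrite raddfD /= gZ // gy addr0.
have hE x : g (qrepr (qproj S x)) = g x.
  apply/eqP; rewrite -subr_eq0 -raddfB.
  by apply: subT; apply/qprojP; rewrite qreprK.
have hB : zmod_morphism (g \o @qrepr R M S).
  elim/qprojW=> x; elim/qprojW=> y.
  by rewrite /= -[qproj S x - _]raddfB !hE raddfB.
pose h : {additive quotmod S -> N} :=
  HB.pack (g \o @qrepr R M S) (GRing.isZmodMorphism.Build _ _ _ hB).
by exists h.
Qed.

Lemma quotring_lift (R T : comPzRingType) (S : R -> Prop)
    (g : {rmorphism R -> T}) :
    (forall x, S x -> g x = 0) ->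
  exists h : {rmorphism quotring S -> T}, forall x, h (rproj S x) = g x.
Proof.
move=> gS; have [c x gx|//|h hE] := @quotmod_lift R R^o S T g.
  by rewrite [LHS](rmorphM g) [g x]gx mulr0.
(* This restates [hE] at the type [quotring S], which carries the product. *)
have {}hE (x : R) : h (rproj S x) = g x by exact: hE.
have hM : monoid_morphism (h : quotring S -> T).
  split=> [|x y]; first by rewrite -[1]/(rproj S 1) hE rmorph1.
  elim/rprojW: x => x; elim/rprojW: y => y.
  by rewrite -rmorphM !hE rmorphM.
pose hr : {rmorphism quotring S -> T} := HB.pack (h : quotring S -> T)
  (GRing.isZmodMorphism.Build (quotring S) T h (raddfB h))
  (GRing.isMonoidMorphism.Build (quotring S) T h hM).
by exists hr.
Qed.

(** * Induction and evaluation in the symmetric algebra *)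

(** The induction is on the degree: a monomial other than 1 has a variable i
    with a positive exponent, and can be divided by it. *)
Lemma cmonom_ind (I : choiceType) (P : {cmonom I} -> Prop) :
  P mone -> (forall i m, P m -> P (mmul (ucm i) m)) -> forall m, P m.
Proof.
move=> P1 PU m; have [d] := ubnP (mdeg m); elim: d m => // d IH m.
have [/mdeg_eq0I-> // | ] := eqVneq (mdeg m) 0%N.
rewrite mdeg_eq0 => m1.
have [i mi] : exists i, m i != 0%N.
  apply: contrapT => /forallNP m0; case/eqP: m1; apply/eqP/cmP => i.
  by rewrite cm1; apply: contrapT => /eqP /m0.
have -> : m = mmul (ucm i) (divcm m (ucm i)).
  apply/eqP/cmP => j; rewrite cmM ucmE divcmE ucmE.
  by case: eqVneq => [<-|_]; rewrite ?subnKC ?lt0n ?subn0.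
rewrite mdegM mdegU add1n ltnS => lt_d; exact/PU/IH.
Qed.

(** The symmetric algebra is generated by constants and vectors, as its
    elements are the images of polynomials in variables indexed by vectors. *)
Lemma symalg_ind (F : fieldType) (W : lmodType F) (P : symalg W -> Prop) :
    (forall c, P (symC W c)) -> (forall w, P (symgen w)) ->
    (forall x y, P x -> P y -> P (x + y)) ->
    (forall x y, P x -> P y -> P (x * y)) ->
  forall x, P x.
Proof.
move=> PC PU PD PM; elim/symprojW => p; rewrite [p]monalgE.
elim/big_rec: _ => [|m q _ Pq].
  by rewrite raddf0 -(rmorph0 (symC W)); apply: PC.
rewrite symprojD; apply: (PD) => //; set c := _ @_ _.
have -> : << c *g m >> = c%:MP * << m >> :> {malg F[{cmonom W}]}.
  by rewrite malgM_def fgmulUU mulr1 mul1m.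
rewrite symprojM; apply: (PM); first by have := PC c; rewrite symC.unlock.
elim/cmonom_ind: m {c} => [|w m Pm].
  rewrite -[<< _ >>]/(1 : {malg F[{cmonom W}]}) rmorph1.
  by rewrite -(rmorph1 (symC W)); apply: PC.
have -> : << mmul (ucm w) m >> = symvar w * << m >> :> {malg F[{cmonom W}]}.
  by rewrite symvar.unlock malgM_def fgmulUU mulr1.
by rewrite symprojM; apply: (PM) => //; apply: PU.
Qed.

Section SymLift.
Variables (F : fieldType) (W : lmodType F) (S : comNzRingType).
Variables (f : {rmorphism F -> S}) (h : {additive W -> S}).

Definition monom_eval (m : {cmonom W}) : S := \prod_(w <- finsupp m) h w ^+ m w.

(** Any finite set containing the support serves as index set, so that the
    evaluations of two monomials can be compared factor by factor. *)
Lemma monom_evalEw (d : {fset W}) (m : {cmonom W}) : (finsupp m `<=` d)%fset ->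
  monom_eval m = \prod_(w <- d) h w ^+ m w.
Proof.
move=> md; rewrite /monom_eval (big_fset_incl _ md) // => w _.
by rewrite -cmE_eq0 => /eqP->.
Qed.

Lemma monom_eval_mmorphism : mmorphism monom_eval.
Proof.
split=> [m1 m2|]; last by rewrite /monom_eval mdom1 big_seq_fset0.
rewrite /= {1}/monom_eval mdomD (monom_evalEw (fsubsetUl _ (finsupp m2))).
rewrite (monom_evalEw (fsubsetUr (finsupp m1) _)) -big_split /=.
by apply: eq_bigr => w _; rewrite cmM exprD.
Qed.

HB.instance Definition _ :=
  isMultiplicative.Build {cmonom W} S monom_eval monom_eval_mmorphism.

Lemma mmap_symvar w : mmap f monom_eval (symvar w) = h w.
Proof.
rewrite symvar.unlock mmapU /= rmorph1 mul1r /monom_eval mdomU big_seq_fset1.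
by rewrite cmUU expr1.
Qed.

(** Evaluation of polynomials at h kills the relations that make the variables
    linear in their indices, precisely because h is linear along f. *)
Lemma symalg_lift : (forall c w, h (c *: w) = f c * h w) ->
  exists g : {rmorphism symalg W -> S},
    (forall c, g (symC W c) = f c) /\ (forall w, g (symgen w) = h w).
Proof.
move=> hZ; have [p|g gE] :=
    @quotring_lift _ S (@symrel F W) (mmap f monom_eval).
  case=> [[w [w' ->]]|[c [w ->]]]; rewrite !raddfB /= ?mmapZ !mmap_symvar.
    by rewrite raddfD /= addrAC addrK subrr.
  by rewrite hZ subrr.
exists g; split=> [c|w].
  rewrite symC.unlock; exact: etrans (gE _) (mmapC _).
exact: etrans (gE _) (mmap_symvar w).
Qed.

End SymLift.

(** * The coordinate ring of the Grassmannian *)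

Lemma semilinear_sum_delta (F : fieldType) (n : nat) (S : comPzRingType)
    (f : {rmorphism F -> S}) (g : 'rV[F]_n -> S) :
    (forall c u v, g (c *: u + v) = f c * g u + g v) ->
  forall u, g u = \sum_(i < n) f (u 0 i) * g (delta_mx 0 i).
Proof.
move=> gP u; rewrite {1}(row_sum_delta u).
elim/big_rec2: _ => [|i x y _ <-]; last by rewrite gP.
(* g 0 = 0, because g 0 = g (1 *: 0 + 0) = g 0 + g 0. *)
apply: (addrI (g 0)).
by rewrite addr0 -{1}[g 0]mul1r -(rmorph1 f) -gP scaler0 addr0.
Qed.

(** A wedge of vectors is a rank one matrix, and the elementary matrices
    delta_mx i j have rank one, so that every generator of the symmetric
    algebra is a combination of wedges. *)
Lemma grring_ind (F : fieldType) (n : nat) (P : grring F n -> Prop) :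
    (forall c, P (grC n c)) -> (forall u v, P (grw u v)) ->
    (forall x y, P x -> P y -> P (x + y)) ->
    (forall x y, P x -> P y -> P (x * y)) ->
  forall x, P x.
Proof.
move=> PC PU PD PM; elim/grprojW; elim/symalg_ind => // [w|x y|x y].
- elim/qprojW: w => t; rewrite [t]matrix_sum_delta.
  have P0 : P (grproj (symgen 0)).
    by have := PU 0 0; rewrite /grw /wedge mulmx0 raddf0.
  elim/big_rec: _ => [|i t' _ Pt']; first by rewrite raddf0.
  rewrite raddfD /= symgenD grprojD; apply: (PD) => //.
  elim/big_rec: _ => [|j t'' _ Pt'']; first by rewrite raddf0.
  rewrite raddfD /= symgenD grprojD; apply: (PD) => //.
  have -> : delta_mx i j = (delta_mx 0 i : 'rV[F]_n)^T *m delta_mx 0 j.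
    by rewrite trmx_delta mul_delta_mx.
  by rewrite linearZ /= symgenZ grprojM; apply: (PM); [apply: PC | apply: PU].
- by rewrite grprojD; apply: PD.
- by rewrite grprojM; apply: PM.
Qed.

(** The universal property of F[Gr(2, V)]: it represents the skew forms on V
    that satisfy the Pluecker relations. *)
Lemma grring_lift (F : fieldType) (n : nat) (S : comNzRingType)
    (f : {rmorphism F -> S}) (b : 'rV[F]_n -> 'rV[F]_n -> S) :
    (forall c u u' v, b (c *: u + u') v = f c * b u v + b u' v) ->
    (forall u v, b v u = - b u v) ->
    (forall u v w z, b u v * b w z + b u w * b z v + b u z * b v w = 0) ->
  exists g : {rmorphism grring F n -> S},
    (forall c, g (grC n c) = f c) /\ (forall u v, g (grw u v) = b u v).
Proof.
move=> bl bC bP.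
have br u c v v' : b u (c *: v + v') = f c * b u v + b u v'.
  by rewrite bC bl opprD -mulrN -!bC.
(* B is the linear map on V (x) V, identified with matrices, attached to b. *)
pose B (t : 'M[F]_n) : S :=
  \sum_i \sum_j f (t i j) * b (delta_mx 0 i) (delta_mx 0 j).
have BB : zmod_morphism B.
  move=> s t; rewrite /B -sumrB; apply: eq_bigr => i _; rewrite -sumrB.
  by apply: eq_bigr => j _; rewrite !mxE raddfB mulrBl.
have BZ c t : B (c *: t) = f c * B t.
  rewrite /B mulr_sumr; apply: eq_bigr => i _; rewrite mulr_sumr.
  by apply: eq_bigr => j _; rewrite !mxE rmorphM mulrA.
have BE u v : B (u^T *m v) = b u v.
  rewrite (semilinear_sum_delta (fun c x y => bl c x y v) u) /B.
  apply: eq_bigr => i _.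
  rewrite (semilinear_sum_delta (br (delta_mx 0 i)) v) mulr_sumr.
  apply: eq_bigr => j _; rewrite mulrA -rmorphM; congr (f _ * _).
  by rewrite mxE big_ord1 mxE.
pose Ba : {additive 'M[F]_n -> S} :=
  HB.pack B (GRing.isZmodMorphism.Build _ _ B BB).
have [c t Bt|_ [u [v ->]]|h hE] := @quotmod_lift _ _ (@skewrel F n) _ Ba.
- by rewrite [LHS]BZ [B t]Bt mulr0.
- by rewrite raddfD /= !BE bC addNr.
have hw u v : h (wedge u v) = b u v by rewrite [LHS]hE [LHS]BE.
have hZ c (x : ext2 F n) : h (c *: x) = f c * h x.
  by elim/qprojW: x => t; rewrite -linearZ !hE [LHS]BZ.
have [g [gC gh]] := @symalg_lift F (ext2 F n) S f h hZ.
have gE u v : g (symgen (wedge u v)) = b u v by exact: etrans (gh _) (hw u v).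
have [_ [u [v [w [z ->]]]]|k kE] := @quotring_lift _ S (@plucker F n) g.
  by rewrite !rmorphD /= !rmorphM /= !gE bP.
by exists k; split=> [c|u v]; rewrite [LHS]kE ?gC ?gE.
Qed.

(** * The free algebra is a Gamma-algebra *)

Section OddModule.
Variables (F : fieldType) (n : nat).
Local Notation grodd := (grodd F n).

Lemma otensZ a b (v : 'rV[F]_n) : a *: otens b v = otens (a * b) v.
Proof. by rewrite /otens -scalerA -linearZ. Qed.

Lemma otens_linear a c (u v : 'rV[F]_n) :
  otens a (c *: u + v) = grC n c *: otens a u + otens a v.
Proof.
rewrite /otens -linearP scalerA mulrC -scalerA -scalerDr.
by rewrite /rowC map_mxD map_mxZ.
Qed.

Lemma grodd_sum (y : 'rV[grring F n]_n) :
  qproj (@oddrel F n) y = \sum_(i < n) otens (y 0 i) (delta_mx 0 i).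
Proof. by rewrite {1}(row_sum_rowC y) raddf_sum. Qed.

Lemma grodd_ind (P : grodd -> Prop) :
    P 0 -> (forall a v x, P x -> P (a *: otens 1 v + x)) -> forall x, P x.
Proof.
move=> P0 PD; elim/qprojW => y; rewrite grodd_sum.
by elim/big_rec: _ => // i x _ Px; rewrite -[y 0 i]mulr1 -otensZ; apply: PD.
Qed.

Lemma otens_cyclic (u v w : 'rV[F]_n) :
  grw u v *: otens 1 w + grw v w *: otens 1 u + grw w u *: otens 1 v = 0.
Proof.
rewrite !otensZ !mulr1 /otens -!raddfD -(raddf0 (qproj (@oddrel F n))).
by apply/qprojP; rewrite subr0 gen_submod_gen //; exists u, v, w.
Qed.

Lemma oddmulC (x y : grodd) : oddmul y x = - oddmul x y.
Proof.
by elim/qprojW: x => x; elim/qprojW: y => y; rewrite !oddmulE rowprodC.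
Qed.

Lemma oddmulZl a (x y : grodd) : oddmul (a *: x) y = a * oddmul x y.
Proof.
have om0 : oddmul 0 y = 0.
  by have := oddmul_linearl (-1) 0 0 y; rewrite scaler0 addr0 mulN1r addNr.
by rewrite -[a *: x]addr0 oddmul_linearl om0 addr0.
Qed.

Lemma oddmulDl (x x' y : grodd) : oddmul (x + x') y = oddmul x y + oddmul x' y.
Proof. by rewrite -{1}[x]scale1r oddmul_linearl mul1r. Qed.

Lemma oddmulZr a (x y : grodd) : oddmul x (a *: y) = a * oddmul x y.
Proof. by rewrite oddmulC oddmulZl oddmulC mulrN opprK. Qed.

Lemma oddmulDr (x y y' : grodd) : oddmul x (y + y') = oddmul x y + oddmul x y'.
Proof. by rewrite oddmulC oddmulDl opprD -!oddmulC. Qed.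

Lemma oddmul0l (y : grodd) : oddmul 0 y = 0.
Proof. by rewrite -(scale0r (0 : grodd)) oddmulZl mul0r. Qed.

Lemma oddmul0r (y : grodd) : oddmul y 0 = 0.
Proof. by rewrite oddmulC oddmul0l oppr0. Qed.

(** The left-hand side of the cyclic identity, as an element of the odd part. *)
Definition oddcyc (x y z : grodd) : grodd :=
  oddmul x y *: z + oddmul y z *: x + oddmul z x *: y.

Lemma oddcyc_rot x y z : oddcyc x y z = oddcyc y z x.
Proof. by rewrite /oddcyc -addrA addrC. Qed.

Lemma oddcyc_linear a x x' y z :
  oddcyc (a *: x + x') y z = a *: oddcyc x y z + oddcyc x' y z.
Proof.
rewrite /oddcyc oddmulDl oddmulDr oddmulZl oddmulZr !scalerDl !scalerDr.
by rewrite !scalerA [a * oddmul y z]mulrC (addrACA (_ *: z)) [LHS]addrACA.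
Qed.

Lemma oddcyc0 y z : oddcyc 0 y z = 0.
Proof. by rewrite /oddcyc oddmul0l oddmul0r !scale0r scaler0 !addr0. Qed.

(** By invariance under rotation, linearity in the first argument yields
    linearity in all three, so one argument at a time can be brought into V;
    there the identity is a defining relation of the odd part. *)
Lemma oddmul_cyclic x y z : oddcyc x y z = 0.
Proof.
have cyc1 u v z' : oddcyc z' (otens 1 u) (otens 1 v) = 0.
  elim/grodd_ind: z' => [|c w z' IH]; first exact: oddcyc0.
  rewrite oddcyc_linear IH addr0 /oddcyc !oddmul_otens !mul1r.
  by rewrite otens_cyclic scaler0.
have cyc2 u z' y' : oddcyc y' z' (otens 1 u) = 0.
  elim/grodd_ind: y' => [|c w y' IH]; first exact: oddcyc0.
  by rewrite oddcyc_linear IH addr0 oddcyc_rot cyc1 scaler0.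
elim/grodd_ind: x => [|c w x IH]; first exact: oddcyc0.
by rewrite oddcyc_linear IH addr0 oddcyc_rot cyc2 scaler0.
Qed.

End OddModule.

Section FreeIsGamma.
Variables (F : fieldType) (n : nat).
Local Notation G := (gamma_free F n).

Lemma gmul_evenl (a : grring F n) (y : gammaT F n) :
  gmul ((a, 0) : gammaT F n) y = (a * y.1, a *: y.2).
Proof. by apply: Defs.pair_eq; rewrite /= ?oddmul0l ?scaler0 !addr0. Qed.

Lemma gmul_odd (x y : grodd F n) :
  gmul ((0, x) : gammaT F n) (0, y) = (oddmul x y, 0).
Proof. by apply: Defs.pair_eq; rewrite /= ?scale0r ?mul0r ?add0r. Qed.

Lemma gamma_free_identity : is_identity ((1, 0) : G).
Proof.
move=> [a x]; rewrite /= gmul_evenl; split; apply: Defs.pair_eq => /=.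
- by rewrite mul1r.
- by rewrite scale1r.
- by rewrite oddmul0r addr0 mulr1.
- by rewrite scaler0 add0r scale1r.
Qed.

Lemma gamma_free_is_gamma : is_gamma G.
Proof.
split; first split.
- by exists (1, 0); split=> //; apply: gamma_free_identity.
- move=> [a ?] [b ?] [c ?] /= -> -> ->; rewrite /asso /= !gmul_evenl /=.
  by rewrite !scaler0 gmul_evenl /= mulrA scaler0 subrr.
- move=> [a ?] [? x] /= -> ->; rewrite /comm /= gmul_evenl /=.
  apply/eqP; rewrite subr_eq0; apply/eqP; apply: Defs.pair_eq => /=.
    by rewrite oddmul0r mul0r mulr0 addr0.
  by rewrite scale0r add0r.
- move=> [a ?] x y /= ->; rewrite /asso /= !gmul_evenl /=.
  apply/eqP; rewrite subr_eq0; apply/eqP; apply: Defs.pair_eq => /=.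
    by rewrite oddmulZl mulrDr !mulrA.
  by rewrite scalerDr !scalerA [y.1 * a]mulrC.
- move=> [? x] [? y] /= -> ->; rewrite /= gmul_odd.
  split=> // [[a ?] /= ->|[a ?] [b ?] /= -> ->].
    rewrite /comm /= !gmul_evenl /= !scaler0 mulrC subrr.
    by apply: Defs.pair_eq.
  rewrite /asso /= !gmul_evenl /= !scaler0 !gmul_evenl /= !scaler0 !mulrA.
  by rewrite !subrr.
- move=> [? x] [? y] /= -> ->; rewrite !gmul_odd [oddmul y x]oddmulC.
  by apply: Defs.pair_eq; rewrite /= ?subrr ?addr0.
- move=> [? x] [? y] [? z] /= -> -> ->; rewrite !gmul_odd.
  rewrite !gmul_evenl; apply: Defs.pair_eq => /=.
    by rewrite !mulr0 !addr0.
  exact: oddmul_cyclic.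
Qed.

End FreeIsGamma.

(** * Products in a Gamma-algebra *)

Section GradedAlgebra.
Variables (F : fieldType) (H : gradedAlg F).
Implicit Types x y z : H.

Lemma amul0l y : amul 0 y = 0.
Proof.
by have := amul_linearl (-1) (0 : H) 0 y; rewrite scaler0 addr0 scaleN1r addNr.
Qed.

Lemma amul0r y : amul y 0 = 0.
Proof.
by have := amul_linearr (-1) (0 : H) 0 y; rewrite scaler0 addr0 scaleN1r addNr.
Qed.

Lemma amulDl x y z : amul (x + y) z = amul x z + amul y z.
Proof. by rewrite -[x in LHS]scale1r amul_linearl scale1r. Qed.

Lemma amulDr x y z : amul x (y + z) = amul x y + amul x z.
Proof. by rewrite -[y in LHS]scale1r amul_linearr scale1r. Qed.

Lemma amulZl c x y : amul (c *: x) y = c *: amul x y.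
Proof. by rewrite -[c *: x]addr0 amul_linearl amul0l addr0. Qed.

Lemma amulZr c x y : amul x (c *: y) = c *: amul x y.
Proof. by rewrite -[c *: y]addr0 amul_linearr amul0r addr0. Qed.

Lemma amulNl x y : amul (- x) y = - amul x y.
Proof. by rewrite -scaleN1r amulZl scaleN1r. Qed.

Lemma amulNr x y : amul x (- y) = - amul x y.
Proof. by rewrite -scaleN1r amulZr scaleN1r. Qed.

Lemma amul_suml I (r : seq I) (G : I -> H) y :
  amul (\sum_(i <- r) G i) y = \sum_(i <- r) amul (G i) y.
Proof. exact: (big_morph _ (fun u v => amulDl u v y) (amul0l y)). Qed.

Lemma amul_sumr I (r : seq I) (G : I -> H) y :
  amul y (\sum_(i <- r) G i) = \sum_(i <- r) amul y (G i).
Proof. exact: (big_morph _ (amulDr y) (amul0r y)). Qed.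

Lemma identity_uniq (e e' : H) : is_identity e -> is_identity e' -> e = e'.
Proof. by move=> /(_ e')[_ eE] /(_ e)[<- _]. Qed.

End GradedAlgebra.

Section EvenCenter.
Variables (F : fieldType) (H : gradedAlg F) (e : H).
Hypotheses (gH : is_gamma H) (e_even : part false e) (e1 : is_identity e).
Implicit Types x y z : H.

Lemma even_assoc a x y : part false a -> amul (amul a x) y = amul a (amul x y).
Proof.
case: gH => [[_ _ _ gA] _ _ _] a0.
by apply/eqP; rewrite -subr_eq0; apply/eqP/gA.
Qed.

Lemma even_odd_comm a x : part false a -> part true x -> amul x a = amul a x.
Proof.
case: gH => [[_ _ gC _] _ _ _] a0 x1.
by apply/eqP; rewrite eq_sym -subr_eq0; apply/eqP/gC.
Qed.

Lemma odd_anticomm x y : part true x -> part true y -> amul y x = - amul x y.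
Proof.
by case: gH => [_ _ gN _] x1 y1; apply/eqP; rewrite -addr_eq0; apply/eqP/gN.
Qed.

(** Even elements associate only when they come first; to take one out of the
    second factor, the two odd factors are exchanged twice. *)
Lemma odd_even_mulA a x y : part false a -> part true x -> part true y ->
  amul x (amul a y) = amul a (amul x y).
Proof.
move=> a0 x1 y1; have ay1 : part true (amul a y) := part_mul a0 y1.
rewrite (odd_anticomm ay1 x1) even_assoc // (odd_anticomm x1 y1).
by rewrite amulNr opprK.
Qed.

(** * The center of the even part as a commutative ring *)

Definition even_center : {pred H} := fun z => `[< center (part false) z >].

(** The conditions on associators hold by themselves in the associative
    algebra H_0. *)
Lemma even_centerP z :
  reflect (part false z /\ forall a, part false a -> amul z a = amul a z)
          (z \in even_center).
Proof.
apply: (iffP (asboolP (center (part false) z))) => [[z0 zC _]|[z0 zC]].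
  by split=> // a a0; apply/eqP; rewrite -subr_eq0; apply/eqP/zC.
case: gH => [[_ gA _ _] _ _ _].
split=> // [a a0|a b a0 b0]; first by rewrite /comm zC // subrr.
by split; apply: gA.
Qed.

Lemma even_center_submod : submod_closed even_center.
Proof.
split=> [|c x y /even_centerP[x0 xC] /even_centerP[y0 yC]].
  apply/even_centerP; split=> [|a _]; first exact: part0.
  by rewrite amul0l amul0r.
apply/even_centerP; split=> [|a a0]; first exact: part_linear.
by rewrite amulDl amulDr amulZl amulZr xC ?yC.
Qed.

HB.instance Definition _ :=
  GRing.isSubmodClosed.Build F H even_center even_center_submod.

Lemma even_center_mul :
  {in even_center &, forall x y, amul x y \in even_center}.
Proof.
move=> x y /even_centerP[x0 xC] /even_centerP[y0 yC].
apply/even_centerP; split=> [|a a0]; first exact: (part_mul x0 y0).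
by rewrite even_assoc // yC // -even_assoc // xC // even_assoc.
Qed.

Lemma even_center_id : e \in even_center.
Proof. by apply/even_centerP; split=> // a _; case: (e1 a) => -> ->. Qed.

Record even_center_ring : Type :=
  EvenCenter { ec_val : H; ec_valP : ec_val \in even_center }.

HB.instance Definition _ := [isSub for ec_val].
HB.instance Definition _ := [Choice of even_center_ring by <:].
HB.instance Definition _ := [SubChoice_isSubZmodule of even_center_ring by <:].

Hypothesis e_neq0 : e != 0.

Definition ec_mul (x y : even_center_ring) : even_center_ring :=
  EvenCenter (even_center_mul (ec_valP x) (ec_valP y)).

Definition ec_one : even_center_ring := EvenCenter even_center_id.

Fact ec_mulA : associative ec_mul.
Proof.
move=> x y z; apply/val_inj; rewrite /= even_assoc //.
by case/even_centerP: (ec_valP x).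
Qed.

Fact ec_mulC : commutative ec_mul.
Proof.
move=> x y; apply/val_inj => /=.
have [_ xC] := even_centerP _ (ec_valP x).
by have [y0 _] := even_centerP _ (ec_valP y); rewrite xC.
Qed.

Fact ec_mul1 : left_id ec_one ec_mul.
Proof. by move=> x; apply/val_inj; case: (e1 (ec_val x)). Qed.

Fact ec_mulDl : left_distributive ec_mul +%R.
Proof. by move=> x y z; apply/val_inj; apply: amulDl. Qed.

Fact ec_one_neq0 : ec_one != 0.
Proof. by apply: contra e_neq0 => /eqP/(congr1 ec_val)/= ->. Qed.

HB.instance Definition _ := GRing.Zmodule_isComNzRing.Build even_center_ring
  ec_mulA ec_mulC ec_mul1 ec_mulDl ec_one_neq0.

Lemma even_center_scal c : c *: e \in even_center.
Proof. by apply: rpredZ; apply: even_center_id. Qed.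

Definition ec_scal (c : F) : even_center_ring :=
  EvenCenter (even_center_scal c).

Fact ec_scal_zmod_morphism : zmod_morphism ec_scal.
Proof. by move=> c d; apply/val_inj; rewrite /= scalerBl. Qed.

Fact ec_scal_monoid_morphism : monoid_morphism ec_scal.
Proof.
split=> [|c d]; apply/val_inj; rewrite /= ?scale1r //.
by rewrite amulZl amulZr (e1 e).1 scalerA.
Qed.

HB.instance Definition _ :=
  GRing.isZmodMorphism.Build F even_center_ring ec_scal ec_scal_zmod_morphism.
HB.instance Definition _ :=
  GRing.isMonoidMorphism.Build F even_center_ring ec_scal
    ec_scal_monoid_morphism.

(** * Extension of a linear map to a homomorphism *)

Lemma odd_mul_center x y :
  part true x -> part true y -> amul x y \in even_center.
Proof. by case: gH => _ gZ _ _ x1 y1; apply/asboolP/gZ. Qed.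

(** This is the cyclic identity for y, z, t multiplied on the right by x: by
    left associativity of the even products it becomes a relation between products
    of pairs, where anticommutativity moves x to the left of its pair, and the
    pairs commute because they are central. *)
Lemma odd_plucker x y z t : part true x -> part true y -> part true z ->
    part true t ->
  amul (amul x y) (amul z t) + amul (amul x z) (amul t y)
  + amul (amul x t) (amul y z) = 0.
Proof.
move=> x1 y1 z1 t1; case: gH => _ _ _ /(_ y z t y1 z1 t1) cyc.
have ev (u v : H) : part true u -> part true v -> part false (amul u v).
  by move=> u1 v1; apply: (part_mul u1 v1).
have oc (u v w s : H) :
    part true u -> part true v -> part true w -> part true s ->
  amul (amul u v) (amul w s) = amul (amul w s) (amul u v).
  move=> u1 v1 w1 s1; have /even_centerP[_ uvC] := odd_mul_center u1 v1.
  by rewrite uvC //; apply: ev.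
have := congr1 (fun s => amul s x) cyc.
rewrite !amulDl amul0l (even_assoc _ _ (ev _ _ y1 z1)).
rewrite (even_assoc _ _ (ev _ _ z1 t1)) (even_assoc _ _ (ev _ _ t1 y1)).
rewrite (odd_anticomm x1 t1) (odd_anticomm x1 y1) (odd_anticomm x1 z1).
rewrite !amulNr -!opprD => /eqP; rewrite oppr_eq0 => /eqP <-.
by rewrite (oc x y) // (oc x z) // (oc x t) // addrC addrA.
Qed.

Section Lift.
Variables (n : nat) (f : {linear 'rV[F]_n -> H}).
Hypothesis f_odd : forall v, part true (f v).

Definition ec_wedge (u v : 'rV[F]_n) : even_center_ring :=
  EvenCenter (odd_mul_center (f_odd u) (f_odd v)).

Lemma even_lift : exists g : {rmorphism grring F n -> even_center_ring},
  (forall c, ec_val (g (grC n c)) = c *: e) /\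
  (forall u v, ec_val (g (grw u v)) = amul (f u) (f v)).
Proof.
have [c u u' v|u v|u v w z|g [gC gw]] := @grring_lift F n _ ec_scal ec_wedge.
- apply/val_inj; rewrite /= linearP amulDl amulZl; congr (_ + _).
  by rewrite amulZl (e1 _).1.
- by apply/val_inj; rewrite /= odd_anticomm.
- by apply/val_inj; apply: odd_plucker.
by exists g; split=> [c|u v]; rewrite ?gC ?gw.
Qed.

(** The odd part of the homomorphism is defined on rows over F[Gr(2, V)] by
    their coordinates in the standard basis of V, and extends f because f is
    linear; the cyclic identity in H lets it pass to the quotient. *)
Lemma gamma_lift : exists phi : {linear gamma_free F n -> H},
  is_gamma_hom phi /\ forall v, phi (gamma_gen v) = f v.
Proof.
have [g [gC gw]] := even_lift; pose g0 a : H := ec_val (g a).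
have g0_even a : part false (g0 a) by case/even_centerP: (ec_valP (g a)).
have g0D a b : g0 (a + b) = g0 a + g0 b by rewrite /g0 rmorphD.
have g0M a b : g0 (a * b) = amul (g0 a) (g0 b) by rewrite /g0 rmorphM.
have g0_1 : g0 1 = e by rewrite /g0 rmorph1.
have g0_0 : g0 0 = 0 by rewrite /g0 rmorph0.
have g0_sum I (r : seq I) (G : I -> grring F n) :
    g0 (\sum_(i <- r) G i) = \sum_(i <- r) g0 (G i).
  exact: (big_morph _ g0D g0_0).
pose d i := f (delta_mx 0 i).
pose g1r (y : 'rV[grring F n]_n) : H := \sum_i amul (g0 (y 0 i)) (d i).
have g1rB : zmod_morphism g1r.
  move=> x y; rewrite /g1r -sumrB; apply: eq_bigr => i _.
  by rewrite !mxE -amulNl -amulDl /g0 raddfB.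
have g1rZ a (y : 'rV[grring F n]_n) : g1r (a *: y) = amul (g0 a) (g1r y).
  rewrite /g1r amul_sumr; apply: eq_bigr => i _.
  by rewrite !mxE g0M even_assoc.
have g1r_rowC v : g1r (rowC v) = f v.
  rewrite [v in RHS]row_sum_delta linear_sum; apply: eq_bigr => i _.
  by rewrite mxE /g0 gC amulZl (e1 _).1 linearZ.
pose g1a : {additive 'rV[grring F n]_n -> H} :=
  HB.pack g1r (GRing.isZmodMorphism.Build _ _ g1r g1rB).
have [a y gy|_ [u [v [w ->]]]|g1 g1E] :=
  @quotmod_lift _ _ (@oddrel F n) _ g1a.
- by rewrite [LHS]g1rZ [g1r y]gy amul0r.
- rewrite !raddfD /= !g1rZ !g1r_rowC /g0 !gw.
  by case: gH => _ _ _; apply.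
have g1Z a (x : grodd F n) : g1 (a *: x) = amul (g0 a) (g1 x).
  by elim/qprojW: x => y; rewrite -linearZ !g1E [LHS]g1rZ.
have g1_odd (x : grodd F n) : part true (g1 x).
  elim/grodd_ind: x => [|a v x Px]; first by rewrite raddf0; apply: part0.
  rewrite raddfD /= g1Z -[amul _ _]scale1r; apply: part_linear => //.
  apply: (part_mul (g0_even a)); rewrite /otens scale1r g1E.
  by rewrite [_ (rowC v)]g1r_rowC.
have g1M (x y : grodd F n) : amul (g1 x) (g1 y) = g0 (oddmul x y).
  elim/qprojW: x => x; elim/qprojW: y => y; rewrite oddmulE !g1E /=.
  rewrite {1}/g1r amul_suml /rowprod g0_sum; apply: eq_bigr => i _.
  rewrite {1}/g1r amul_sumr g0_sum; apply: eq_bigr => j _.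
  rewrite (even_assoc _ _ (g0_even _)).
  rewrite (odd_even_mulA (g0_even _) (f_odd _) (f_odd _)).
  by rewrite -(even_assoc _ _ (g0_even _)) !g0M /g0 gw.
pose phi (x : gamma_free F n) : H := g0 x.1 + g1 x.2.
have phiP : linear phi.
  move=> c [a x] [b y]; rewrite /phi /= g0D g0M raddfD /= g1Z.
  by rewrite /g0 gC !amulZl !(e1 _).1 addrACA scalerDr.
pose phiL : {linear gamma_free F n -> H} :=
  HB.pack phi (GRing.isLinear.Build F (gamma_free F n) H *:%R phi phiP).
exists phiL; split; last first.
  by move=> v; rewrite /= /phi /= g0_0 add0r /otens scale1r g1E [LHS]g1r_rowC.
split=> [[a x] [b y]|i i1|[] [a x]] /=.
- rewrite /phi /= g0D g0M raddfD /= !g1Z -g1M amulDl !amulDr.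
  rewrite (even_odd_comm (g0_even b) (g1_odd x)) -!addrA.
  by congr (_ + _); rewrite addrC addrA.
- rewrite (identity_uniq i1 (@gamma_free_identity F n)).
  by rewrite /phi /= g0_1 raddf0 addr0.
- by move=> ->; rewrite /phi /= g0_0 add0r.
- by move=> ->; rewrite /phi /= raddf0 addr0.
Qed.

End Lift.
End EvenCenter.

(** * Uniqueness of the extension *)

(** Two homomorphisms agree at 1 since each maps it to an identity, and an
    identity is unique; they agree at u /\ v because it is a product of two
    elements of V. *)
Lemma gamma_hom_uniq (F : fieldType) (n : nat) (H : gradedAlg F)
    (phi psi : {linear gamma_free F n -> H}) :
    is_gamma_hom phi -> is_gamma_hom psi ->
    (forall v, phi (gamma_gen v) = psi (gamma_gen v)) -> phi =1 psi.
Proof.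
move=> [phiM phi1 _] [psiM psi1 _] gen_eq.
pose G := gamma_free F n.
have eqM (x y : G) : phi x = psi x -> phi y = psi y ->
    phi (amul x y) = psi (amul x y).
  by rewrite phiM psiM => -> ->.
have eqD (x y : G) : phi x = psi x -> phi y = psi y ->
    phi (x + y) = psi (x + y).
  by rewrite !raddfD /= => -> ->.
have even_eq a : phi ((a, 0) : G) = psi ((a, 0) : G).
  elim/grring_ind: a => [c|u v|a b Pa Pb|a b Pa Pb].
  - have -> : ((grC n c, 0) : G) = c *: ((1, 0) : G).
      by apply: Defs.pair_eq; rewrite /= ?mulr1 ?scaler0.
    have id1 := @gamma_free_identity F n.
    by rewrite !linearZ (identity_uniq (phi1 _ id1) (psi1 _ id1)).
  - have <- : amul (gamma_gen u) (gamma_gen v) = ((grw u v, 0) : G).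
      by rewrite [LHS]gmul_odd oddmul_otens !mul1r.
    exact: eqM.
  - have -> : ((a + b, 0) : G) = ((a, 0) : G) + ((b, 0) : G).
      by apply: Defs.pair_eq; rewrite /= ?addr0.
    exact: eqD.
  - have <- : amul ((a, 0) : G) ((b, 0) : G) = ((a * b, 0) : G).
      by rewrite [LHS]gmul_evenl /= scaler0.
    exact: eqM.
have odd_eq x : phi ((0, x) : G) = psi ((0, x) : G).
  elim/grodd_ind: x => [|a v x Px]; first exact: even_eq.
  have -> : ((0, a *: otens 1 v + x) : G)
          = amul ((a, 0) : G) (gamma_gen v) + ((0, x) : G).
    rewrite [amul _ _]gmul_evenl.
    by apply: Defs.pair_eq; rewrite /= ?mulr0 ?addr0.
  by apply: (eqD) => //; apply: eqM.
move=> [a x]; have -> : ((a, x) : G) = ((a, 0) : G) + ((0, x) : G).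
  by apply: Defs.pair_eq; rewrite /= ?addr0 ?add0r.
exact: eqD.
Qed.

Theorem theorem5 (F : fieldType) (n : nat) :
  is_free_gamma (V := 'rV[F]_n) (G := gamma_free F n) (@gamma_gen F n).
Proof.
split=> [|c u v|//|H f gH f_odd].
- exact: gamma_free_is_gamma.
- apply: Defs.pair_eq; rewrite /= ?mulr0 ?addr0 //.
  exact: otens_linear.
split=> [|phi psi phiP phif psiP psif]; last first.
  by apply: gamma_hom_uniq => // v; rewrite phif psif.
have [[[e [e0 e1]] _ _ _] _ _ _] := gH.
(* If e = 0 then H = 0, and the zero map is a homomorphism. *)
have [ez|enz] := eqVneq e 0; last exact: (gamma_lift gH e0 e1 enz f_odd).
have H0 (x : H) : x = 0 by rewrite -[x](e1 x).1 ez amul0l.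
exists (\0 : {linear gamma_free F n -> H}).
split; last by move=> v; rewrite [RHS]H0 [LHS]H0.
split=> [x y|i _ x|b x _]; first by rewrite [RHS]H0 [LHS]H0.
  by split; rewrite [RHS]H0 [LHS]H0.
by rewrite [_ x]H0; apply: part0.
Qed.
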